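(* Every nonsingular real symmetric $n\times n$ matrix $A$ has the $i$-SNIP for each index $i\in[n]$.
   Context: $A$ has the $i$-SNIP if $X=O$ is the only real symmetric matrix $X$ with $A\circ X=O$, $I\circ X=O$ ($\circ$ the entrywise product) and $(AX)(i,:]=O$, where $(AX)(i,:]$ is $AX$ with row $i$ deleted. *)

(* Defs.v *)
From mathcomp Require Import all_boot all_order all_algebra.
From mathcomp Require Import reals.

Set Implicit Arguments.
Unset Strict Implicit.
Unset Printing Implicit Defensive.

Import GRing.Theory.
Local Open Scope ring_scope.

Definition hadamard (R : realType) (m n : nat) (A B : 'M[R]_(m, n)) :
    'M[R]_(m, n) :=
  map2_mx (fun x y => x * y) A B.

Definition has_SNIP (R : realType) (n : nat) (i : 'I_n) (A : 'M[R]_n) : Prop :=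
  forall X : 'M[R]_n,
    X^T = X ->
    hadamard A X = 0 ->
    hadamard 1%:M X = 0 ->
    row' i (A *m X) = 0 ->
    X = 0.

(* Main.v *)
Require Import Defs.
From mathcomp Require Import all_boot all_order all_algebra.
From mathcomp Require Import reals.

Set Implicit Arguments.
Unset Strict Implicit.
Unset Printing Implicit Defensive.

Import GRing.Theory.
Local Open Scope ring_scope.

(** Only row [i] of [A *m X] can be nonzero, so [X] is the rank-one product of
    column [i] of the inverse of [A] with that row. A symmetric matrix [b w^T]
    satisfies [X k l ^ 2 = X k l * X l k = X k k * X l l], which vanishes when
    the diagonal of [X] does. *)

Lemma row'_eq0P (V : nmodType) (m n : nat) (i : 'I_m) (B : 'M[V]_(m, n)) :
  row' i B = 0 -> forall k l, k != i -> B k l = 0.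
Proof.
move=> B0 k l; rewrite eq_sym => /unlift_some [j -> _].
by have /matrixP /(_ j l) := B0; rewrite !mxE.
Qed.

(** Expand [X = invmx A *m (A *m X)] entrywise: in the sum over rows of [A *m X], only the term at
    [i] survives. *)
Lemma entry_row'_mulmx_eq0 (R : comUnitRingType) (m n : nat) (i : 'I_m)
    (A : 'M[R]_m) (X : 'M[R]_(m, n)) :
  A \in unitmx -> row' i (A *m X) = 0 ->
  forall k l, X k l = invmx A k i * (A *m X) i l.
Proof.
move=> uA AX0 k l; rewrite -[in LHS](mulKmx uA X) mxE (bigD1 i) //=.
by rewrite big1 ?addr0 // => j ji; rewrite (row'_eq0P AX0) // mulr0.
Qed.

Theorem proposition3p2 (R : realType) (n : nat) (A : 'M[R]_n)
  (symA : A^T = A) (nsA : A \in unitmx) (i : 'I_n) : has_SNIP i A.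
Proof.
move=> X symX _ diagX /(entry_row'_mulmx_eq0 nsA) XE.
have X0 k : X k k = 0.
  by have /matrixP /(_ k k) := diagX; rewrite !mxE eqxx mul1r.
have Xsym k l : X l k = X k l by rewrite -[in LHS]symX mxE.
apply/matrixP => k l; rewrite mxE; apply/eqP.
rewrite -sqrf_eq0 expr2 -[X in _ * X]Xsym (XE k l) (XE l k).
(* With [b] for column [i] of [invmx A] and [w] for row [i] of [A *m X], this regroups
   [(b k * w l) * (b l * w k)] as [(b k * w k) * (b l * w l)], whose first factor is the diagonal
   entry [X k k]. *)
by rewrite mulrACA [X in _ * X]mulrC mulrACA -(XE k k) X0 !mul0r.
Qed.
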